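(* Let $R$ be a ring and $M$ a left $R$-module. Then the following statements are equivalent: (1) $M$ is semi-compact; (2) $M$ has the injective property relative to every $(\aleph_0,1)$-pure exact sequence $0\rightarrow A\rightarrow B\rightarrow C\rightarrow 0$ of left $R$-modules where $C$ is a cyclic left $R$-module; (3) $M$ is a direct summand of every single $(\aleph_0,1)$-pure extension of $M$; (4) every pure extension of $M$ is cyclically pure, i.e. whenever $M$ is a pure submodule of a left $R$-module $B$, the exact sequence $0\to M\to B\to B/M\to 0$ is cyclically pure; (5) $M$ is a direct summand of every left $R$-module $B$ such that $B$ contains $M$ as an $(\aleph_0,1)$-pure submodule and $B/M$ is a direct summand of a direct sum of cyclic left $R$-modules; (6) $M$ has the injective property relative to every $(\aleph_0,1)$-pure exact sequence $0\rightarrow A\rightarrow B\rightarrow C\rightarrow 0$ of left $R$-modules where $C$ is a direct summand of a direct sum of cyclic left $R$-modules; (7) $M$ is singly pure-injective.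
   Context: Rings are associative with identity and modules are unitary. For a left ideal $I$ of $R$, $M[I]=\{m\in M\mid Im=0\}$. A left $R$-module $M$ is semi-compact if every set of congruences $x\equiv x_\alpha\pmod{M[I_\alpha]}$ ($\alpha\in\Lambda$, $x_\alpha\in M$, $I_\alpha$ a left ideal of $R$), each finite subset of which has a common solution in $M$, has a simultaneous solution in $M$. A short exact sequence of left $R$-modules is pure (respectively $(\aleph_0,1)$-pure, cyclically pure) if every finitely presented (respectively every finitely presented cyclic, every cyclic) left $R$-module is projective relative to it. A submodule $A$ of $B$ is pure (respectively $(\aleph_0,1)$-pure) if $0\to A\to B\to B/A\to 0$ is pure (respectively $(\aleph_0,1)$-pure); then $B$ is called a pure (respectively $(\aleph_0,1)$-pure) extension of $A$. $M$ has the injective property relative to $0\to A\to B\to C\to 0$ if every homomorphism $A\to M$ extends to $B$. A left $R$-module $B$ containing $M$ is a single extension of $M$ if $B/M$ is cyclic; it is a single $(\aleph_0,1)$-pure extension of $M$ if it is both a single extension and an $(\aleph_0,1)$-pure extension of $M$. For $M\subseteq B$, $M$ is singly split in $B$ if for every submodule $A$ of $B$ which is a single extension of $M$, $M$ is a direct summand of $A$. $M$ is singly pure-injective if $M$ is singly split in every pure extension of $M$. *)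

(* Defs.v *)
From HB Require Import structures.
From mathcomp Require Import all_boot all_order all_algebra.
From mathcomp Require Import generic_quotient ring_quotient.
From mathcomp Require Import boolp classical_sets functions cardinality fsbigop.

Set Implicit Arguments.
Unset Strict Implicit.
Unset Printing Implicit Defensive.

Import GRing.Theory.
Local Open Scope classical_set_scope.
Local Open Scope ring_scope.

(* Rings are [pzRingType]s: associative with identity, the zero ring allowed.
   A left ideal of R is a submodule of the regular left module R^o.
   [submodClosed V] is a bool-valued predicate; by the classical axioms of
   [boolp] every Prop-valued submodule is of this form. *)

(* [ring_quotient] provides [Quotient.quot N] for N closed under + and -, as a
   zmodType only; the scalar action is added here. *)
Section QuotientModule.
Variables (R : pzRingType) (B : lmodType R) (N : submodClosed B).

Definition quotmod_den : {pred B} := fun b => b \in N.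
HB.instance Definition _ := GRing.isZmodClosed.Build B quotmod_den
  (GRing.submod_closedB (submodClosedP N)).

Definition quotmod : Type := Quotient.quot quotmod_den.
HB.instance Definition _ := GRing.Zmodule.on quotmod.

Definition quotmod_pi (b : B) : quotmod := \pi_(Quotient.quot quotmod_den)%qT b.
Definition quotmod_scale (a : R) (x : quotmod) : quotmod :=
  quotmod_pi (a *: (repr (x : Quotient.quot quotmod_den))).

Lemma quotmod_piP x y : quotmod_pi x = quotmod_pi y <-> x - y \in N.
Proof.
have E : (x - y \in N) = (quotmod_pi x == quotmod_pi y :> quotmod).
  exact: (@Quotient.idealrBE _ quotmod_den x y).
by rewrite E; split=> [->|/eqP].
Qed.

Lemma quotmod_piD : {morph quotmod_pi : x y / x + y}.
Proof. by move=> x y; exact: (@Quotient.pi_add _ quotmod_den x y). Qed.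

Lemma quotmod_pi_surj x : exists b, quotmod_pi b = x.
Proof.
exists (repr (x : Quotient.quot quotmod_den)); exact: reprK.
Qed.

Lemma quotmod_piZ a b : quotmod_pi (a *: b) = quotmod_scale a (quotmod_pi b).
Proof.
apply/quotmod_piP; rewrite -scalerBr rpredZ //.
by apply/quotmod_piP; rewrite /quotmod_pi reprK.
Qed.

Fact quotmod_scaleA a b v :
  quotmod_scale a (quotmod_scale b v) = quotmod_scale (a * b) v.
Proof.
by have [x <-] := quotmod_pi_surj v; rewrite -!quotmod_piZ scalerA.
Qed.
Fact quotmod_scale1 : left_id 1 quotmod_scale.
Proof.
by move=> v; have [x <-] := quotmod_pi_surj v; rewrite -quotmod_piZ scale1r.
Qed.
Fact quotmod_scaleDr : right_distributive quotmod_scale +%R.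
Proof.
move=> a u v; have [x <-] := quotmod_pi_surj u.
have [y <-] := quotmod_pi_surj v.
by rewrite -!quotmod_piZ -!quotmod_piD -quotmod_piZ scalerDr.
Qed.
Fact quotmod_scaleDl v : {morph quotmod_scale^~ v : a b / a + b}.
Proof.
move=> a b; have [x <-] := quotmod_pi_surj v.
by rewrite /= -!quotmod_piZ -quotmod_piD scalerDl.
Qed.
HB.instance Definition _ := GRing.Zmodule_isLmodule.Build R quotmod
  quotmod_scaleA quotmod_scale1 quotmod_scaleDr quotmod_scaleDl.

Fact quotmod_pi_is_linear : linear quotmod_pi.
Proof. by move=> a x y; rewrite quotmod_piD quotmod_piZ. Qed.
HB.instance Definition _ :=
  GRing.isLinear.Build R B quotmod _ quotmod_pi quotmod_pi_is_linear.

End QuotientModule.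

(* Throughout, submodules "A of B" of a given module A are represented by
   injective linear maps A -> B, and B/A is then the cokernel of that map. *)
Section Modules.
Variable R : pzRingType.
Implicit Types A B C D M P : lmodType R.

Definition lin_image A B (i : {linear A -> B}) : {pred B} :=
  fun b => `[< exists a, i a = b >].

Fact lin_image_submod A B (i : {linear A -> B}) : submod_closed (lin_image i).
Proof.
split=> [|r x y /asboolP[a <-] /asboolP[a' <-]]; apply/asboolP.
  by exists 0; rewrite linear0.
by exists (r *: a + a'); rewrite linearP.
Qed.
HB.instance Definition _ A B (i : {linear A -> B}) :=
  GRing.isSubmodClosed.Build R B (lin_image i) (lin_image_submod i).

Definition coker A B (i : {linear A -> B}) : lmodType R :=
  quotmod (lin_image i).
Definition coker_pi A B (i : {linear A -> B}) : {linear B -> coker i} :=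
  @quotmod_pi R B (lin_image i).

Definition surjective_map (T U : Type) (f : T -> U) : Prop :=
  forall u, exists t, f t = u.

Definition exact_at A B C (i : {linear A -> B}) (p : {linear B -> C}) : Prop :=
  forall b, p b = 0 <-> exists a, i a = b.

Definition short_exact A B C (i : {linear A -> B}) (p : {linear B -> C}) :
    Prop :=
  [/\ injective i, exact_at i p & surjective_map p].

Lemma coker_short_exact A B (i : {linear A -> B}) :
  injective i -> short_exact i (coker_pi i).
Proof.
move=> i_inj; split=> // [b|]; last exact: quotmod_pi_surj.
rewrite -(linear0 (coker_pi i)); split=> [/quotmod_piP|ib].
  by rewrite subr0 => /asboolP.
by apply/quotmod_piP; rewrite subr0; apply/asboolP.
Qed.

Definition cyclic_module C : Prop :=
  exists c : C, forall x : C, exists r : R, x = r *: c.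

(* R^m -> R^n -> P -> 0 exact *)
Definition finitely_presented P : Prop :=
  exists (m n : nat) (f : {linear 'rV[R]_m -> 'rV[R]_n})
         (g : {linear 'rV[R]_n -> P}), exact_at f g /\ surjective_map g.

(* Relative projectivity and the purity notions for 0 -> A -> B -> C -> 0 only
   mention the map p : B -> C; they are used for p ending an exact sequence. *)
Definition projective_rel P B C (p : {linear B -> C}) : Prop :=
  forall f : {linear P -> C}, exists g : {linear P -> B}, forall x, p (g x) = f x.

Definition pure_seq B C (p : {linear B -> C}) : Prop :=
  forall P, finitely_presented P -> projective_rel P p.

Definition aleph0_1_pure_seq B C (p : {linear B -> C}) : Prop :=
  forall P, finitely_presented P -> cyclic_module P -> projective_rel P p.

Definition cyclically_pure_seq B C (p : {linear B -> C}) : Prop :=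
  forall P, cyclic_module P -> projective_rel P p.

Definition injective_rel M A B (i : {linear A -> B}) : Prop :=
  forall f : {linear A -> M}, exists g : {linear B -> M}, forall a, g (i a) = f a.

Definition pure_extension A B (i : {linear A -> B}) : Prop :=
  injective i /\ pure_seq (coker_pi i).

Definition aleph0_1_pure_extension A B (i : {linear A -> B}) : Prop :=
  injective i /\ aleph0_1_pure_seq (coker_pi i).

Definition single_extension A B (i : {linear A -> B}) : Prop :=
  injective i /\ cyclic_module (coker i).

Definition single_aleph0_1_pure_extension A B (i : {linear A -> B}) : Prop :=
  single_extension i /\ aleph0_1_pure_extension i.

(* B = i(A) (+) N for some submodule N of B *)
Definition direct_summand A B (i : {linear A -> B}) : Prop :=
  injective i /\
  exists N : submodClosed B,
    (forall b, exists a : A, exists2 n, n \in N & b = i a + n) /\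
    (forall b, b \in lin_image i -> b \in N -> b = 0).

(* D is the direct sum of the modules C l, with canonical injections inj l:
   every element of D is uniquely a sum of a finitely supported family. *)
Definition is_direct_sum (L : choiceType) (C : L -> lmodType R) D
    (inj : forall l, {linear C l -> D}) : Prop :=
  forall d : D, exists! c : (forall l, C l),
    finite_set [set l | c l != 0] /\
    d = \sum_(l \in [set: L]) inj l (c l).

Definition summand_of_direct_sum_of_cyclics C : Prop :=
  exists (L : choiceType) (Z : L -> lmodType R) D
         (inj : forall l, {linear Z l -> D}) (j : {linear C -> D}),
    [/\ forall l, cyclic_module (Z l), is_direct_sum inj & direct_summand j].

(* M[I] = {m | I m = 0}; only an additive subgroup of M in general *)
Definition annihilated M (I : submodClosed R^o) : set M :=
  [set m | forall r : R, (r : R^o) \in I -> r *: m = 0].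

Definition semi_compact M : Prop :=
  forall (L : Type) (x : L -> M) (I : L -> submodClosed R^o),
    (forall S : set L, finite_set S ->
       exists y : M, forall l, S l -> annihilated (I l) (y - x l)) ->
    exists y : M, forall l, annihilated (I l) (y - x l).

(* A ranges over the submodules of B containing i(M), k being the
   corestriction of i to A. *)
Definition singly_split M B (i : {linear M -> B}) : Prop :=
  forall A (j : {linear A -> B}) (k : {linear M -> A}),
    injective j -> (forall m, j (k m) = i m) ->
    single_extension k -> direct_summand k.

Definition singly_pure_injective M : Prop :=
  forall B (i : {linear M -> B}), pure_extension i -> singly_split i.

End Modules.

(* Main.v *)
From HB Require Import structures.
Require Import Defs.
From mathcomp Require Import all_boot all_order all_algebra.
From mathcomp Require Import finmap.
From mathcomp Require Import boolp classical_sets functions cardinality.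
From mathcomp Require Import fsbigop filter.

Set Implicit Arguments.
Unset Strict Implicit.
Unset Printing Implicit Defensive.

Import GRing.Theory.
Local Open Scope classical_set_scope.
Local Open Scope ring_scope.

(** The seven conditions meet in one elementary property: every system of
    equations r *: y = m in a single unknown y of M, each of whose finite
    subsystems has a solution in M, has a solution in M.  Semi-compactness is
    this property, because y = x modulo M[I] says r *: y = r *: x for r in I,
    and because a single equation r *: y = m is a congruence modulo M[Rr]
    ([semi_compactP]).

    Such systems control lifting problems with cyclic source.  Let
    0 -> M -> B -> C -> 0 be exact, c a generator of P and P -> C linear with
    c going to the class of b.  Lifting it amounts to correcting b by some y in
    M so that the annihilator of c kills b - y, which is a system
    r *: y = r *: b.  When only finitely many r are involved, P may be replaced
    by a cyclic finitely presented module, so an (aleph_0,1)-pure sequence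
    makes the system finitely solvable ([aleph0_1_pure_solution]).  Hence, over
    a semi-compact M, (aleph_0,1)-pure sequences starting at M are cyclically
    pure ([cyclically_pure_of_semi_compact]), and a fortiori every direct
    summand of a direct sum of cyclic modules is projective relative to them.
    Applied to the push-out of a sequence 0 -> A -> B -> C -> 0 along A -> M,
    this splits the push-out, which is the extension of A -> M to B
    ([injective_rel_of_semi_compact]).  The other positive conditions are
    special cases of this or of cyclic purity.

    For the converse, each condition implies that M is singly pure-injective:
    if M is pure in B and M <= A <= B, then M is pure in A, since lifts to B of
    maps into A / M land in A ([projective_rel_intermediate]).  Finally, given
    a finitely solvable system, choose for each finite list of its equations a
    solution in M.  These choices form an element yhat of the reduced power of
    M over the filter of large lists; yhat solves the whole system, and M is
    pure in its reduced power ([reduced_power_exists]).  A retraction of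
    M + R yhat onto M sends yhat to a solution in M
    ([semi_compact_of_singly_pure_injective]). *)

(** * Constructing linear maps and quotient modules *)

(** A linear map is often obtained by choosing values compatibly with a
    relation; being a function and being linear then both follow from the
    relation being a submodule of X * Y that meets 0 * Y trivially. *)
Lemma linear_of_graph (R : pzRingType) (X Y : lmodType R) (G : X -> Y -> Prop) :
  (forall x, exists y, G x y) ->
  (forall a x x' y y', G x y -> G x' y' -> G (a *: x + x') (a *: y + y')) ->
  (forall y, G 0 y -> y = 0) ->
  exists g : {linear X -> Y}, forall x, G x (g x).
Proof.
move=> /choice[g Gg] G_lin G0.
have G_fun x y y' : G x y -> G x y' -> y = y'.
  move=> Gy Gy'; apply/eqP; rewrite -subr_eq0; apply/eqP/G0.
  by have := G_lin (- 1) _ _ _ _ Gy' Gy; rewrite !scaleN1r addNr addrC.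
have g_lin : linear g.
  by move=> a x x'; apply: G_fun (Gg _) _; apply: G_lin.
by exists (HB.pack_for {linear X -> Y} g
  (GRing.isLinear.Build R X Y _ g g_lin)).
Qed.

Lemma exists_linear (R : pzRingType) (X Y : lmodType R) (g : X -> Y) :
  linear g -> exists g' : {linear X -> Y}, g' =1 g.
Proof.
move=> g_lin; apply: (@linear_of_graph _ _ _ (fun x y => y = g x)).
- by move=> x; exists (g x).
- by move=> a x x' _ _ -> ->; rewrite g_lin.
- by move=> _ ->; have := g_lin (- 1) 0 0; rewrite !scaleN1r oppr0 addr0 addNr.
Qed.

Lemma linear_factor_surjection (R : pzRingType) (X P B : lmodType R)
    (g : {linear X -> P}) (h : {linear X -> B}) :
  surjective_map g -> (forall x, g x = 0 -> h x = 0) ->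
  exists h' : {linear P -> B}, forall x, h' (g x) = h x.
Proof.
move=> g_surj gh; pose G p b := exists x, g x = p /\ h x = b.
have [|||h' Gh'] := @linear_of_graph _ _ _ G.
- by move=> p; have [x <-] := g_surj p; exists (h x), x.
- move=> a _ _ _ _ [x [<- <-]] [x' [<- <-]].
  by exists (a *: x + x'); rewrite !linearP.
- by move=> _ [x [/gh hx <-]].
exists h' => x; have [x' [gx' <-]] := Gh' (g x).
by apply/esym/eqP; rewrite -subr_eq0 -linearB gh// linearB gx' subrr.
Qed.

Lemma linear_factor_injection (R : pzRingType) (X A B : lmodType R)
    (j : {linear A -> B}) (h : {linear X -> B}) :
  injective j -> (forall x, exists a, j a = h x) ->
  exists h' : {linear X -> A}, forall x, j (h' x) = h x.
Proof.
move=> j_inj hj; apply: (@linear_of_graph _ _ _ (fun x a => j a = h x)) => //.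
- by move=> a x x' y y' jy jy'; rewrite !linearP jy jy'.
- by move=> a; rewrite linear0 => ja; apply: j_inj; rewrite ja linear0.
Qed.

(** Classically, a submodule given by a Prop-valued set has a boolean
    membership test. *)
Lemma submodClosed_of_set (R : pzRingType) (B : lmodType R) (S : set B) :
  S 0 -> (forall a x y, S x -> S y -> S (a *: x + y)) ->
  exists N : submodClosed B, forall b, b \in N <-> S b.
Proof.
move=> S0 S_lin; pose N : {pred B} := fun b => `[< S b >].
have N_closed : submod_closed N.
  by split=> [|a x y /asboolP Sx /asboolP Sy]; apply/asboolP=> //; apply: S_lin.
exists (HB.pack_for (submodClosed B) N
  (GRing.isSubmodClosed.Build R B N N_closed)) => b.
by split=> /asboolP.
Qed.

Lemma quotient_exists (R : pzRingType) (B : lmodType R) (S : set B) :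
  S 0 -> (forall a x y, S x -> S y -> S (a *: x + y)) ->
  exists (Q : lmodType R) (q : {linear B -> Q}),
    surjective_map q /\ forall b, q b = 0 <-> S b.
Proof.
move=> S0 /(submodClosed_of_set S0)[N NS].
exists (quotmod N), (@quotmod_pi R B N); split=> [|b].
  exact: quotmod_pi_surj.
by rewrite -NS -[b in b \in N]subr0 -quotmod_piP linear0.
Qed.

Lemma coker_exact (R : pzRingType) (A B : lmodType R) (i : {linear A -> B}) :
  exact_at i (coker_pi i).
Proof.
move=> b; rewrite -(linear0 (coker_pi i)); split=> [/quotmod_piP|ib].
  by rewrite subr0 => /asboolP.
by apply/quotmod_piP; rewrite subr0; apply/asboolP.
Qed.

Lemma image_factorization (R : pzRingType) (X B : lmodType R)
    (h : {linear X -> B}) :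
  exists (A : lmodType R) (e : {linear X -> A}) (j : {linear A -> B}),
    [/\ surjective_map e, injective j & forall x, j (e x) = h x].
Proof.
have [||A [e [e_surj e0]]] := @quotient_exists R X [set x | h x = 0].
- exact: linear0.
- by move=> a x y /= hx hy; rewrite linearP hx hy scaler0 addr0.
have [|j je] := linear_factor_surjection (h := h) e_surj.
  by move=> x /e0.
exists A, e, j; split=> // u v; have [x <-] := e_surj u.
have [y <-] := e_surj v; rewrite !je => hxy.
apply/eqP; rewrite -subr_eq0 -linearB; apply/eqP/e0 => /=.
by rewrite linearB hxy subrr.
Qed.

(** A complement N gives the retraction sending b to the unique a with
    b - i a in N; conversely the kernel of a retraction is a complement. *)
Lemma direct_summandP (R : pzRingType) (A B : lmodType R)
    (i : {linear A -> B}) :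
  direct_summand i <-> exists g : {linear B -> A}, cancel i g.
Proof.
split=> [[i_inj [N [N_sum N_int]]]|[g gK]].
  have [|||g gN] := @linear_of_graph R B A (fun b a => b - i a \in N).
  - move=> b; have [a [n nN ->]] := N_sum b.
    by exists a; rewrite addrC addKr.
  - move=> r x x' y y' xy xy'; rewrite linearP opprD addrACA -scalerBr.
    exact: rpredD (rpredZ _ _) _.
  - move=> a; rewrite sub0r -linearN => aN.
    have /eqP : i (- a) = 0 by apply: N_int => //; apply/asboolP; exists (- a).
    by rewrite -(linear0 i) (inj_eq i_inj) oppr_eq0 => /eqP.
  exists g => a; apply: i_inj; apply/esym/eqP; rewrite -subr_eq0; apply/eqP.
  by apply: N_int => //; apply/asboolP; exists (a - g (i a)); rewrite linearB.
split; first exact: can_inj gK.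
have [||N Ng] := @submodClosed_of_set R B [set b | g b = 0].
- exact: linear0.
- by move=> a x y /= gx gy; rewrite linearP gx gy scaler0 addr0.
exists N; split=> [b|_ /asboolP[a <-] /Ng /=]; last first.
  by rewrite gK => ->; rewrite linear0.
exists (g b), (b - i (g b)); last by rewrite addrC subrK.
by apply/Ng; rewrite /= linearB gK subrr.
Qed.

Lemma retraction_of_section (R : pzRingType) (A B C : lmodType R)
    (i : {linear A -> B}) (p : {linear B -> C}) (s : {linear C -> B}) :
  short_exact i p -> cancel s p -> exists g : {linear B -> A}, cancel i g.
Proof.
move=> [i_inj ip p_surj] sK.
have [|||g ig] := @linear_of_graph R B A (fun b a => i a = b - s (p b)).
- by move=> b; apply/ip; rewrite linearB sK subrr.
- by move=> a x x' y y' e e'; rewrite !linearP e e' /= scalerDr addrACA.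
- by move=> a; rewrite !linear0 addr0 => ia; apply: i_inj; rewrite ia linear0.
have pi a : p (i a) = 0 by apply/ip; exists a.
by exists g => a; apply: i_inj; rewrite ig pi linear0 subr0.
Qed.

(** * Linear systems in one unknown and semi-compactness *)

(** The map out of the free module 'rV_n that sends the standard basis to b. *)
Definition row_combination (R : pzRingType) (B : lmodType R) n (b : 'I_n -> B)
    (v : 'rV[R]_n) : B := \sum_j v 0 j *: b j.

Fact row_combination_is_linear (R : pzRingType) (B : lmodType R) n
  (b : 'I_n -> B) : linear (row_combination b).
Proof.
move=> a u v; rewrite /row_combination scaler_sumr -big_split /=.
by apply: eq_bigr => j _; rewrite !mxE scalerDl scalerA.
Qed.
HB.instance Definition _ (R : pzRingType) (B : lmodType R) n (b : 'I_n -> B) :=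
  GRing.isLinear.Build R 'rV[R]_n B _ (row_combination b)
    (row_combination_is_linear b).

Lemma row_combination_delta (R : pzRingType) (B C : lmodType R) n
    (p : {linear B -> C}) (h : {linear 'rV[R]_n -> C}) (b : 'I_n -> B) :
  (forall j, p (b j) = h (delta_mx 0 j)) ->
  forall v, p (row_combination b v) = h v.
Proof.
move=> pb v; rewrite /row_combination linear_sum [in RHS](row_sum_delta v).
by rewrite linear_sum; apply: eq_bigr => j _; rewrite !linearZ /= pb.
Qed.

(** A pair (r, m) in E stands for the equation r *: y = m.  Finite subsystems
    are cut out by arbitrary lists s, so that no proof of membership in E has
    to be carried along with the elements of s. *)
Definition finitely_solvable (R : pzRingType) (M : lmodType R)
    (E : set (R * M)) : Prop :=
  forall s : seq (R * M), exists y : M,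
    forall e, e \in s -> E e -> e.1 *: y = e.2.

Definition solvable (R : pzRingType) (M : lmodType R)
    (E : set (R * M)) : Prop :=
  exists y : M, forall e, E e -> e.1 *: y = e.2.

(** Each equation has a solution x of its own, and y is a solution of it exactly
    when y - x is killed by the left ideal generated by its coefficient. *)
Lemma semi_compact_solvable (R : pzRingType) (M : lmodType R)
    (E : set (R * M)) :
  semi_compact M -> finitely_solvable E -> solvable E.
Proof.
move=> M_sc E_fin.
have E_sol (e : {e | E e}) : exists y, (sval e).1 *: y = (sval e).2.
  have [y ys] := E_fin [:: sval e].
  by exists y; apply: ys (svalP e); rewrite inE.
have [x xE] := choice E_sol.
(* The left ideal R r, as the image of the map 'rV_1 -> R that sends the basis
   vector to r. *)
pose I (e : {e | E e}) : submodClosed R^o :=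
  lin_image (row_combination (fun _ : 'I_1 => (sval e).1 : R^o)).
have annI e y : annihilated (I e) (y - x e) <-> (sval e).1 *: y = (sval e).2.
  rewrite -xE; split=> [yx|yx r /asboolP[u <-]].
    apply/eqP; rewrite -subr_eq0 -scalerBr; apply/eqP/yx/asboolP.
    by exists (const_mx 1); rewrite /= /row_combination big_ord1 mxE scale1r.
  rewrite /= /row_combination big_ord1.
  rewrite -[X in X *: _]/(u 0 ord0 * (sval e).1) -scalerA scalerBr yx subrr.
  exact: scaler0.
have [|y yE] := M_sc _ x I.
  move=> S /(finite_image sval)/finite_seqP[s sE]; have [y ys] := E_fin s.
  exists y => e Se; apply/annI/ys; last exact: svalP.
  by have : [set` s] (sval e) by rewrite -sE; exists e.
by exists y => e Ee; have /annI := yE (exist _ e Ee).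
Qed.

(** The congruence y = x l modulo M[I l] is the set of equations
    r *: y = r *: x l for r in I l. *)
Lemma semi_compactP (R : pzRingType) (M : lmodType R) :
  semi_compact M <-> forall E : set (R * M), finitely_solvable E -> solvable E.
Proof.
split=> [M_sc E|M_solv L x I x_fin]; first exact: semi_compact_solvable.
pose E (e : R * M) := exists2 l, (e.1 : R^o) \in I l & e.2 = e.1 *: x l.
have [s|y yE] := M_solv E.
  have [S [S_fin sS]] : exists S : set L, finite_set S /\
      forall e, e \in s -> E e ->
        exists l, [/\ S l, (e.1 : R^o) \in I l & e.2 = e.1 *: x l].
    elim: s => [|e s [S [S_fin sS]]]; first by exists set0; split.
    have [[l el e2]|Ee] := pselect (E e).
      exists (S `|` [set l]); split.
        by rewrite finite_setU; split=> //; exact: finite_set1.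
      move=> e'; rewrite inE => /predU1P[-> _|/sS /[apply]].
        by exists l; split=> //; right.
      by move=> [l' [? ? ?]]; exists l'; split=> //; left.
    by exists S; split=> // e'; rewrite inE => /predU1P[-> //|/sS].
  have [y yS] := x_fin S S_fin; exists y => e es Ee.
  have [l [Sl el ->]] := sS e es Ee.
  by apply/eqP; rewrite -subr_eq0 -scalerBr; apply/eqP/(yS l).
exists y => l r rI; rewrite scalerBr (yE (r, r *: x l)) ?subrr//.
by exists l.
Qed.

(** * Lifting properties of pure sequences *)

(** The finitely many coefficients r of s generate a left ideal J, and R / J is
    cyclic and finitely presented.  As r *: b lies in A for these r, the class
    of b in C defines a map R / J -> C; a lift to B sends 1 to some b' killed
    by J, and y = b - b' lies in A and solves the equations. *)
Lemma aleph0_1_pure_solution (R : pzRingType) (A B C : lmodType R)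
    (i : {linear A -> B}) (p : {linear B -> C}) (b : B) (s : seq (R * A)) :
  short_exact i p -> aleph0_1_pure_seq p ->
  (forall e, e \in s -> i e.2 = e.1 *: b) ->
  exists y : A, forall e, e \in s -> e.1 *: y = e.2.
Proof.
move=> [i_inj ip p_surj] p_pure sb.
pose t : 'cV[R]_(size s) := \col_k (nth 0 s k).1.
pose f : {linear 'rV[R]_(size s) -> 'rV[R]_1} := mulmxr t.
have P_cyc : cyclic_module (coker f).
  exists (coker_pi f (const_mx 1)) => x; have [v <-] := quotmod_pi_surj x.
  exists (v 0 0); rewrite -linearZ; congr (coker_pi f _).
  by apply/rowP => k; rewrite ord1 !mxE mulr1.
have P_fp : finitely_presented (coker f).
  exists (size s), 1%N, f, (coker_pi f); split; first exact: coker_exact.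
  exact: quotmod_pi_surj.
have [||h hE] := @linear_factor_surjection R _ _ _ (coker_pi f)
  (row_combination (fun _ => p b)).
- exact: quotmod_pi_surj.
- move=> v /coker_exact[u <-]; rewrite /= /row_combination big_ord1 mxE.
  rewrite scaler_suml big1// => k _; rewrite mxE -scalerA -linearZ.
  rewrite (_ : p _ = 0) ?scaler0//; apply/ip; exists (nth 0 s k).2.
  exact/sb/mem_nth.
have [g gE] := p_pure _ P_fp P_cyc h.
pose b' := g (coker_pi f (const_mx 1)).
have [y iy] : exists y, i y = b - b'.
  apply/ip; rewrite linearB gE hE /= /row_combination big_ord1 mxE scale1r.
  by rewrite subrr.
exists y => e es; apply: i_inj; rewrite linearZ /= iy scalerBr -sb//.
rewrite (_ : _ *: b' = 0) ?subr0// -linearZ -linearZ.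
rewrite [X in g X](_ : _ = 0) ?linear0//; apply/coker_exact.
exists (delta_mx 0 (Ordinal (etrans (index_mem e s) es))).
rewrite /f /= -rowE; apply/rowP => k; rewrite ord1 !mxE nth_index//.
by rewrite mulr1.
Qed.

(** With b above the image of the generator c, the unknown y must satisfy
    r *: i y = r *: b for all r killing c: then c may be sent to b - i y. *)
Lemma cyclically_pure_of_semi_compact (R : pzRingType) (M B C : lmodType R)
    (i : {linear M -> B}) (p : {linear B -> C}) :
  semi_compact M -> short_exact i p -> aleph0_1_pure_seq p ->
  cyclically_pure_seq p.
Proof.
move=> M_sc ses p_pure P [c c_gen] h.
have [i_inj ip p_surj] := ses; have [b pb] := p_surj (h c).
pose E (e : R * M) := e.1 *: c = 0 /\ i e.2 = e.1 *: b.
have [s|y yE] := @semi_compact_solvable R M E M_sc.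
  pose s' := [seq e <- s | `[< E e >]].
  have [e|y ys] := aleph0_1_pure_solution (b := b) (s := s') ses p_pure.
    by rewrite mem_filter => /andP[/asboolP[]].
  by exists y => e es Ee; apply: ys; rewrite mem_filter es andbT; apply/asboolP.
have b'0 r : r *: c = 0 -> r *: (b - i y) = 0.
  move=> rc; have [m im] : exists m, i m = r *: b.
    by apply/ip; rewrite linearZ /= pb -linearZ rc linear0.
  by rewrite scalerBr -linearZ /= (yE (r, m)) ?im ?subrr//.
have [|||g gE] := @linear_of_graph R P B
    (fun x z => exists r, x = r *: c /\ z = r *: (b - i y)).
- by move=> x; have [r ->] := c_gen x; exists (r *: (b - i y)), r.
- move=> a _ _ _ _ [r [-> ->]] [r' [-> ->]]; exists (a * r + r').
  by rewrite !scalerDl !scalerA.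
- by move=> _ [r [/esym rc ->]]; exact: b'0.
exists g => x; have [r [xE ->]] := gE x.
have -> : p (r *: (b - i y)) = r *: (p b - p (i y)) by rewrite linearZ linearB.
rewrite (_ : p (i y) = 0); last by apply/ip; exists y.
by rewrite subr0 pb -linearZ xE.
Qed.

(** Sums over a direct sum have supports depending on the element; this puts the
    sums of several families over a common finite index list. *)
Lemma fsum_setT_finite (L : choiceType) (V : zmodType) (A : set L)
    (F : L -> V) :
  finite_set A -> (forall l, ~ A l -> F l = 0) ->
  \sum_(l \in [set: L]) F l = \sum_(l <- fset_set A) F l.
Proof.
move=> A_fin FA; rewrite -fsbig_finite//; apply/esym/fsbig_widen => //.
by move=> l [_ /FA].
Qed.

(** Lifts on the summands are assembled into one lift, which is well defined
    because the coordinates of an element are unique. *)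
Lemma projective_rel_direct_sum (R : pzRingType) (L : choiceType)
    (Z : L -> lmodType R) (D B C : lmodType R)
    (inj : forall l, {linear Z l -> D}) (p : {linear B -> C}) :
  is_direct_sum inj -> (forall l, projective_rel (Z l) p) -> projective_rel D p.
Proof.
move=> D_sum Z_proj f.
pose s l := projT1 (cid (Z_proj l (f \o inj l))).
have sE l z : p (s l z) = f (inj l z) := projT2 (cid (Z_proj l (f \o inj l))) z.
pose supp (c : forall l, Z l) := [set l | c l != 0].
pose G d b := exists c : forall l, Z l,
  [/\ finite_set (supp c), d = \sum_(l \in [set: L]) inj l (c l)
    & b = \sum_(l \in [set: L]) s l (c l)].
have sumE (V : lmodType R) (t : forall l, {linear Z l -> V}) c A :
    finite_set A -> supp c `<=` A ->
    \sum_(l \in [set: L]) t l (c l) = \sum_(l <- fset_set A) t l (c l).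
  move=> A_fin cA; apply: fsum_setT_finite => // l nAl.
  have [->|cl] := eqVneq (c l) 0; first exact: linear0.
  by case: nAl; apply: cA.
have [|||g gG] := @linear_of_graph R D B G.
- move=> d; have [c [[c_fin dE] _]] := D_sum d.
  by exists (\sum_(l \in [set: L]) s l (c l)), c.
- move=> a _ _ _ _ [c [c_fin -> ->]] [c' [c'_fin -> ->]].
  pose A := supp c `|` supp c'; pose c'' l := a *: c l + c' l.
  have A_fin : finite_set A by rewrite finite_setU.
  have c''A : supp c'' `<=` A.
    move=> l; rewrite /supp /c'' /A /= => cl.
    have [c0|] := eqVneq (c l) 0; last by left.
    by right; move: cl; rewrite c0 scaler0 add0r.
  have linE (V : lmodType R) (t : forall l, {linear Z l -> V}) :
      a *: (\sum_(l \in [set: L]) t l (c l))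
      + \sum_(l \in [set: L]) t l (c' l) = \sum_(l \in [set: L]) t l (c'' l).
    rewrite !(@sumE V t _ A)//; [|by right|by left].
    rewrite scaler_sumr -big_split; apply: eq_bigr => l _.
    by rewrite linearP.
  by exists c''; rewrite !linE; split=> //; exact: sub_finite_set A_fin.
- move=> b [c [c_fin c0 ->]].
  have [c1 [_ c1_uniq]] := D_sum 0.
  have cE : c1 = c by apply: c1_uniq.
  have zeroE : c1 = (fun l => 0).
    apply: c1_uniq; split.
      rewrite (_ : [set l | _] = set0); first exact: finite_set0.
      by apply/seteqP; split=> l //=; rewrite eqxx.
    by rewrite fsbig1// => l _; rewrite linear0.
  by rewrite fsbig1// => l _; rewrite -cE zeroE linear0.
exists g => d; have [c [c_fin -> ->]] := gG d.
rewrite !(@sumE _ _ c _ c_fin)// !linear_sum.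
by apply: eq_bigr => l _; exact: sE.
Qed.

Lemma projective_rel_summand (R : pzRingType) (P D B C : lmodType R)
    (j : {linear P -> D}) (p : {linear B -> C}) :
  direct_summand j -> projective_rel D p -> projective_rel P p.
Proof.
move=> /direct_summandP[q jK] D_proj f.
have [g gE] := D_proj (f \o q); exists (g \o j) => x.
by rewrite /= gE /= jK.
Qed.

Lemma projective_rel_summand_of_cyclics (R : pzRingType) (P B C : lmodType R)
    (p : {linear B -> C}) :
  cyclically_pure_seq p -> summand_of_direct_sum_of_cyclics P ->
  projective_rel P p.
Proof.
move=> p_pure [L [Z [D [inj [j [Z_cyc D_sum j_summand]]]]]].
apply: projective_rel_summand j_summand _.
by apply: projective_rel_direct_sum D_sum _ => l; apply: p_pure.
Qed.

Lemma cyclic_summand_of_cyclics (R : pzRingType) (C : lmodType R) :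
  cyclic_module C -> summand_of_direct_sum_of_cyclics C.
Proof.
move=> C_cyc.
exists unit, (fun _ => C), C, (fun _ => idfun), idfun; split=> //; last first.
  by apply/direct_summandP; exists idfun.
have sumE (c : unit -> C) : \sum_(l \in [set: unit]) c l = c tt.
  rewrite (_ : [set: unit] = [set tt]) ?fsbig_set1//.
  by apply/seteqP; split=> -[].
move=> d; exists (fun=> d); split=> [|c [_ ->]].
  by rewrite sumE; split=> //; exact: finite_finset.
by apply/funext => -[]; rewrite sumE.
Qed.

(** * Extending maps into a semi-compact module *)

(** The push-out is the quotient of M * B by the elements (f a, - i a); the map
    k stays injective because i is. *)
Lemma pushout_exists (R : pzRingType) (A B C M : lmodType R)
    (i : {linear A -> B}) (p : {linear B -> C}) (f : {linear A -> M}) :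
  short_exact i p ->
  exists (E : lmodType R) (k : {linear M -> E}) (u : {linear B -> E})
         (q : {linear E -> C}),
    [/\ short_exact k q, forall b, q (u b) = p b
      & forall a, u (i a) = k (f a)].
Proof.
move=> [i_inj ip p_surj].
have [||E [w [w_surj w0]]] :=
    @quotient_exists R (M * B)%type [set mb | exists a, mb = (f a, - i a)].
- by exists 0; rewrite !linear0.
- move=> r _ _ [a ->] [a' ->]; exists (r *: a + a').
  by rewrite !linearP.
have [k kE] : exists k : {linear M -> E}, k =1 (fun m => w (m, 0)).
  apply: exists_linear => r m m'; rewrite -linearP; congr (w _).
  by congr pair; rewrite /= scaler0 addr0.
have [u uE] : exists u : {linear B -> E}, u =1 (fun b => w (0, b)).
  apply: exists_linear => r b b'; rewrite -linearP; congr (w _).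
  by congr pair; rewrite /= scaler0 addr0.
have [pr prE] : exists pr : {linear (M * B)%type -> C}, pr =1 p \o snd.
  by apply: exists_linear => r x x'; rewrite /= linearP.
have pi a : p (i a) = 0 by apply/ip; exists a.
have [|q qE] := linear_factor_surjection (h := pr) w_surj.
  by move=> x /w0[a ->]; rewrite prE /= linearN pi oppr0.
exists E, k, u, q; split=> [|b|a]; last 2 first.
- by rewrite uE qE prE.
- rewrite uE kE; apply/eqP; rewrite -subr_eq0 -linearB; apply/eqP/w0.
  exists (- a); rewrite !linearN opprK; congr pair; rewrite /= ?sub0r ?subr0//.
split=> [m m' km|x|c].
- have : w (m - m', 0) = 0.
    have := congr1 (fun z => z - k m') km; rewrite subrr => <-.
    by rewrite !kE -linearB; congr (w (_, _)); rewrite /= subr0.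
  move=> /w0[a [ma /esym/eqP]]; rewrite oppr_eq0 => /eqP ia.
  apply/eqP; rewrite -subr_eq0 ma (_ : a = 0) ?linear0//.
  by apply: i_inj; rewrite ia linear0.
- split=> [|[m <-]]; last by rewrite kE qE prE /= linear0.
  have [[m b] <-] := w_surj x; rewrite qE prE => /ip[a ia].
  exists (m + f a); rewrite kE; apply/eqP; rewrite -subr_eq0 -linearB.
  apply/eqP/w0; exists a; rewrite ia; congr pair => /=.
    by rewrite addrC addKr.
  exact: sub0r.
- by have [b <-] := p_surj c; exists (u b); rewrite uE qE prE.
Qed.

(** The push-out of the sequence along f is again (aleph_0,1)-pure, since lifts
    to B can be pushed forward; hence it splits, and composing its retraction
    onto M with B -> E extends f. *)
Lemma injective_rel_of_semi_compact (R : pzRingType) (M A B C : lmodType R)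
    (i : {linear A -> B}) (p : {linear B -> C}) :
  semi_compact M -> short_exact i p -> aleph0_1_pure_seq p ->
  summand_of_direct_sum_of_cyclics C -> injective_rel M i.
Proof.
move=> M_sc ses p_pure C_sum f.
have [E [k [u [q [kq qu ui]]]]] := pushout_exists f ses.
have q_pure : aleph0_1_pure_seq q.
  move=> P P_fp P_cyc h; have [g gE] := p_pure P P_fp P_cyc h.
  by exists (u \o g) => x; rewrite /= qu gE.
have q_cyc := cyclically_pure_of_semi_compact M_sc kq q_pure.
have [s sK] := projective_rel_summand_of_cyclics q_cyc C_sum idfun.
have [g gK] := retraction_of_section kq sK.
by exists (g \o u) => a; rewrite /= ui gK.
Qed.

(** * From singly pure-injective to semi-compact *)

(** For M <= A <= B, a lift to B of a map P -> A / M <= B / M takes its values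
    in A, because M <= A.  So purity of M in B passes to A. *)
Lemma projective_rel_intermediate (R : pzRingType) (P M A B : lmodType R)
    (i : {linear M -> B}) (k : {linear M -> A}) (j : {linear A -> B}) :
  injective j -> (forall m, j (k m) = i m) ->
  projective_rel P (coker_pi i) -> projective_rel P (coker_pi k).
Proof.
move=> j_inj jk P_proj f.
have pi_surj : surjective_map (coker_pi k) by exact: quotmod_pi_surj.
have [|phi phiE] := linear_factor_surjection (h := coker_pi i \o j) pi_surj.
  by move=> a /coker_exact[m <-]; apply/coker_exact; exists m.
have [g gE] := P_proj (phi \o f).
have gj x : exists2 a, j a = g x & coker_pi k a = f x.
  have [a fx] := pi_surj (f x).
  have /coker_exact[m im] : coker_pi i (g x - j a) = 0.
    by rewrite linearB gE /= -fx phiE subrr.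
  exists (a + k m); first by rewrite linearD jk im addrC subrK.
  rewrite linearD fx (_ : coker_pi k (k m) = 0) ?addr0//.
  by apply/coker_exact; exists m.
have [|g' jg'] := linear_factor_injection (h := g) j_inj.
  by move=> x; have [a ja _] := gj x; exists a.
exists g' => x; have [a ja <-] := gj x; congr (coker_pi k _).
by apply: j_inj; rewrite jg'.
Qed.

(** The reduced power of M over the filter F, with its diagonal embedding i.
    It is pure: the relations of a finitely presented module P over M are
    finitely many linear equations, satisfied in the reduced power by some
    elements q (b j) with right-hand sides in M.  They then hold at almost all
    coordinates t, hence at one t; subtracting the values b j t, which lie in M,
    makes the right-hand sides vanish without changing classes modulo M. *)
Lemma reduced_power_exists (R : pzRingType) (M : lmodType R) (T : Type)
    (F : set_system T) :
  ProperFilter F ->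
  exists (B : lmodType R) (i : {linear M -> B}) (q : {linear (T -> M) -> B}),
    [/\ pure_extension i,
        forall phi, q phi = 0 <-> \forall t \near F, phi t = 0
      & forall m, i m = q (fun=> m)].
Proof.
move=> F_proper.
have [||B [q [q_surj q0]]] :=
    @quotient_exists R (T -> M) [set phi | \forall t \near F, phi t = 0].
- exact: nearW.
- move=> a phi psi /= phi0 psi0; near=> t; rewrite /GRing.add /GRing.scale /=.
  by rewrite (near phi0 t)// (near psi0 t)// scaler0 addr0.
have [i iE] : exists i : {linear M -> B}, i =1 (fun m => q (fun=> m)).
  by apply: exists_linear => a m m'; rewrite -linearP.
exists B, i, q; split=> //; split.
  move=> m m'; rewrite !iE => /eqP; rewrite -subr_eq0 -linearB => /eqP/q0/=.
  by move=> /filter_ex[t] /eqP; rewrite subr_eq0 => /eqP.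
move=> P [m [n [f [g [fg g_surj]]]]] h.
have b_ex (j : 'I_n) : exists b, coker_pi i (q b) = h (g (delta_mx 0 j)).
  have [x <-] := quotmod_pi_surj (h (g (delta_mx 0 j))).
  by have [b <-] := q_surj x; exists b.
have [b bE] := choice b_ex.
have wE : forall v, coker_pi i (q (row_combination b v)) = h (g v).
  exact: (@row_combination_delta R _ _ n (coker_pi i \o q) (h \o g) b bE).
have c_ex (k : 'I_m) : exists c, i c = q (row_combination b (f (delta_mx 0 k))).
  by apply/coker_exact; rewrite wE (proj2 (fg _)) ?linear0//; eexists.
have [c cE] := choice c_ex.
have /filter_ex[t tE] : \forall t \near F, forall k,
    row_combination b (f (delta_mx 0 k)) t = c k.
  apply: filter_forall => k.
  have /q0 : q (row_combination b (f (delta_mx 0 k)) - (fun=> c k)) = 0.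
    by rewrite linearB -iE cE subrr.
  by apply: filterS => t /eqP; rewrite subr_eq0 => /eqP.
pose b' j := q (b j) - i (b j t).
have b'E v : row_combination b' v =
    q (row_combination b v) - i (row_combination b v t).
  rewrite /row_combination (linear_sum q) fct_sumE (linear_sum i) -sumrB.
  by apply: eq_bigr => j _; rewrite scalerBr -!linearZ.
have [|g' g'E] := linear_factor_surjection (h := row_combination b') g_surj.
  move=> _ /fg[u <-]; rewrite (row_sum_delta u) !linear_sum big1// => k _.
  by rewrite !linearZ /= b'E tE cE subrr scaler0.
exists g' => x; have [v <-] := g_surj x; rewrite g'E /= b'E linearB wE.
rewrite (_ : coker_pi i (i _) = 0) ?subr0//; apply/coker_exact.
by eexists.
Unshelve. all: end_near.
Qed.

(** The reduced power is indexed by finite lists s of equations, for the filter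
    generated by the sets of lists containing a given one; at s, the element y
    solves the part of the system that lies in s.  The intermediate module A is
    M + R (q y), the image of M * R^o in the reduced power. *)
Lemma semi_compact_of_singly_pure_injective (R : pzRingType) (M : lmodType R) :
  singly_pure_injective M -> semi_compact M.
Proof.
move=> M_spi; apply/semi_compactP => E /choice[y yE].
pose F : set_system (seq (R * M)) :=
  filter_from setT (fun s0 : seq (R * M) => [set s | {subset s0 <= s}]).
have F_proper : ProperFilter F.
  apply: filter_from_proper => [|s _]; last by exists s => ?.
  apply: filter_fromT_filter => [|s1 s2]; first by exists [::].
  exists (s1 ++ s2) => s /= s12.
  by split=> e es; apply: s12; rewrite mem_cat es ?orbT.
have [B [i [q [i_pure q0 iE]]]] := @reduced_power_exists R M _ F F_proper.
have qy e : E e -> e.1 *: q y = i e.2.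
  move=> Ee; rewrite iE -linearZ; apply/eqP; rewrite -subr_eq0 -linearB.
  apply/eqP/q0; exists [:: e] => // s /= es; apply/eqP; rewrite subr_eq0.
  by apply/eqP/yE => //; apply: es; rewrite inE.
have [h hE] : exists h : {linear (M * R^o)%type -> B},
    h =1 (fun mr => i mr.1 + (mr.2 : R) *: q y).
  by apply: exists_linear => r [m a] [m' a'] /=; rewrite linearP scalerDl
    -scalerA scalerDr addrACA.
have [A [e [j [e_surj j_inj je]]]] := image_factorization h.
have [k kE] : exists k : {linear M -> A}, k =1 (fun m => e (m, 0)).
  apply: exists_linear => r m m'; rewrite -linearP; congr (e _).
  by congr pair; rewrite /= scaler0 addr0.
have jk m : j (k m) = i m by rewrite kE je hE /= scale0r addr0.
have k_single : single_extension k.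
  split=> [m m' kmm'|]; first by apply: (proj1 i_pure); rewrite -!jk kmm'.
  exists (coker_pi k (e (0, 1))) => x; have [a <-] := quotmod_pi_surj x.
  have [[m r] <-] := e_surj a; exists r.
  rewrite -linearZ; apply/eqP; rewrite -subr_eq0 -linearB -linearZ -linearB.
  apply/eqP/coker_exact; exists m; rewrite kE; congr (e _).
  by congr pair; rewrite /= ?scaler0 ?subr0// [_ *: _]mulr1 subrr.
have /direct_summandP[g gK] := M_spi B i i_pure A j k j_inj jk k_single.
exists (g (e (0, 1))) => -[r m] /= Erm.
rewrite -linearZ -linearZ -[RHS]gK; congr (g _); apply: j_inj.
rewrite jk je hE /= scaler0 linear0 add0r [X in X *: _]mulr1.
exact: (qy (r, m) Erm).
Qed.



Theorem theorem1p1 (R : pzRingType) (M : lmodType R) :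
  [<-> semi_compact M;
       forall (A B C : lmodType R)
               (i : {linear A -> B}) (p : {linear B -> C}),
               short_exact i p -> aleph0_1_pure_seq p -> cyclic_module C ->
               injective_rel M i;
       forall (B : lmodType R) (i : {linear M -> B}),
               single_aleph0_1_pure_extension i -> direct_summand i;
       forall (B : lmodType R) (i : {linear M -> B}),
               pure_extension i -> cyclically_pure_seq (coker_pi i);
       forall (B : lmodType R) (i : {linear M -> B}),
               aleph0_1_pure_extension i ->
               summand_of_direct_sum_of_cyclics (coker i) ->
               direct_summand i;
       forall (A B C : lmodType R)
               (i : {linear A -> B}) (p : {linear B -> C}),
               short_exact i p -> aleph0_1_pure_seq p ->
               summand_of_direct_sum_of_cyclics C ->
               injective_rel M i;
       singly_pure_injective M].
Proof.
set P1 := semi_compact M; set P2 := (X in all_iff _ (X :: _)).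
set P3 := (X in all_iff _ [:: _, X & _]).
set P4 := (X in all_iff _ [:: _, _, X & _]).
set P5 := (X in all_iff _ [:: _, _, _, X & _]).
set P6 := (X in all_iff _ [:: _, _, _, _, X & _]).
have P71 : singly_pure_injective M -> P1.
  exact: semi_compact_of_singly_pure_injective.
have P14 : P1 -> P4.
  move=> M_sc B i [i_inj i_pure].
  apply: cyclically_pure_of_semi_compact M_sc (coker_short_exact i_inj) _.
  by move=> P P_fp _; exact: i_pure.
have P16 : P1 -> P6.
  by move=> M_sc A B C i p; exact: injective_rel_of_semi_compact.
have P62 : P6 -> P2.
  move=> M_inj A B C i p ses p_pure /cyclic_summand_of_cyclics.
  exact: M_inj ses p_pure.
have P65 : P6 -> P5.
  move=> M_inj B i [i_inj i_pure] C_sum; apply/direct_summandP.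
  exact: M_inj (coker_short_exact i_inj) i_pure C_sum idfun.
have P53 : P5 -> P3.
  move=> M_split B i [[i_inj C_cyc] i_pure]; apply: M_split => //.
  exact: cyclic_summand_of_cyclics.
have P23 : P2 -> P3.
  move=> M_inj B i [[i_inj C_cyc] [_ i_pure]]; apply/direct_summandP.
  exact: M_inj (coker_short_exact i_inj) i_pure C_cyc idfun.
have P37 : P3 -> singly_pure_injective M.
  move=> M_split B i [i_inj i_pure] A j k j_inj jk k_single.
  apply: M_split; split=> //; split=> [|P P_fp _]; first by case: k_single.
  exact: projective_rel_intermediate j_inj jk (i_pure P P_fp).
have P47 : P4 -> singly_pure_injective M.
  move=> M_cyc B i [i_inj i_pure] A j k j_inj jk [k_inj C_cyc].
  have k_pure : pure_extension k.
    split=> // P P_fp.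
    exact: projective_rel_intermediate j_inj jk (i_pure P P_fp).
  have [s sK] := M_cyc A k k_pure _ C_cyc idfun.
  apply/direct_summandP.
  exact: retraction_of_section (coker_short_exact k_inj) sK.
by tfae; tauto.
Qed.
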